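(* Let $n\ge2$ and let $v:\mathbb{C}^n\to\mathbb{CP}^n$ be an equivariant map, written in the form $$v(z)=\frac{1}{\sqrt2\,(1+u_3)^{1/2}}\left[1+u_3,\,(u_1+iu_2)\frac zr\right],\qquad r=|z|,$$ with $u(r)=(u_1(r),u_2(r),u_3(r))\in\mathbb{S}^2\subset\mathbb{R}^3$. Then the energy is given in the $u$ coordinates by $$\mathcal{E}(v)=\frac12\int_{\mathbb{R}^{2n}}|dv|^2\,dx=\frac12\int_{\mathbb{R}^{2n}}\left[|u_r|^2+\frac1{r^2}\left[1-u_3^2+2(2n-2)(1-u_3)\right]\right]dx .$$
   Context: Points of $\mathbb{CP}^n$ are written in homogeneous coordinates $[z_0,z_1,\dots,z_n]$, and $\mathbb{CP}^n=\mathbb{S}^{2n+1}/\sim$ with $z\sim e^{i\theta}z$. A map $v:\mathbb{C}^n\to\mathbb{CP}^n$ is equivariant if $v(Az)=\tilde A v(z)$ for all complex isometries (unitary maps) $A$ of $\mathbb{C}^n$ and all $z$, where $\tilde A[z_0,z_1,\dots,z_n]=[z_0,A(z_1,\dots,z_n)]$. $\mathbb{CP}^n$ carries the Fubini-Study metric (the metric induced by the quotient of $\mathbb{S}^{2n+1}$), normalized so that the map $\mathbb{S}^2\ni(a_1,a_2,a_3)\mapsto[1+a_3,a_1+ia_2]\in\mathbb{CP}^1$ from the unit sphere of $\mathbb{R}^3$ is an isometry, i.e. so that each complex line is isometric to the unit sphere $\mathbb{S}^2$ (this is $4$ times the quotient metric from the unit sphere $\mathbb{S}^{2n+1}$). $|dv|^2$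 is the usual energy density (squared Hilbert-Schmidt norm of the differential with respect to the Euclidean metric on $\mathbb{C}^n\cong\mathbb{R}^{2n}$ and the metric on $\mathbb{CP}^n$). $u$ is assumed regular enough (e.g. $C^1$ for $r>0$) for the expressions to make sense; both sides may be infinite. *)

(* Defs.v *)
From HB Require Import structures.
From mathcomp Require Import all_boot all_order all_algebra generic_quotient.
From mathcomp Require Import spectral complex.
From mathcomp Require Import all_classical all_reals all_analysis.

Set Implicit Arguments.
Unset Strict Implicit.
Unset Printing Implicit Defensive.

Import Order.TTheory GRing.Theory Num.Theory.
Import numFieldNormedType.Exports.

Local Open Scope classical_set_scope.
Local Open Scope ring_scope.
Local Open Scope complex_scope.
Local Open Scope sesquilinear_scope.
Local Open Scope quotient_scope.

Section HermitianSpace.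
Context {R : realType}.

(* Linear in the second argument. *)
Definition cdot {m} (p q : 'cV[R[i]]_m) : R[i] := (p ^t* *m q) 0 0.

Definition sqnorm {m} (p : 'cV[R[i]]_m) : R := complex.Re (cdot p p).

Definition cnorm {m} (p : 'cV[R[i]]_m) : R := Num.sqrt (sqnorm p).

(* C^m is identified with R^(2m) by (x, y) <-> x + i y, the m real parts coming
   first. *)
Definition of_real {m} (x : 'rV[R]_(m + m)) : 'cV[R[i]]_m :=
  \col_k (x 0 (lshift m k) +i* x 0 (rshift m k)).

Definition to_real {m} (p : 'cV[R[i]]_m) : 'rV[R]_(m + m) :=
  row_mx (\row_k complex.Re (p k 0)) (\row_k complex.Im (p k 0)).

Definition realified {m k} (F : 'cV[R[i]]_m -> 'cV[R[i]]_k) :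
  'rV[R]_(m + m) -> 'rV[R]_(k + k) := to_real \o F \o of_real.

(* Differentiability over R, not over C. *)
Definition rdifferentiable {m k} (F : 'cV[R[i]]_m -> 'cV[R[i]]_k)
    (z : 'cV[R[i]]_m) : Prop :=
  differentiable (realified F) (to_real z).

Definition rdiff {m k} (F : 'cV[R[i]]_m -> 'cV[R[i]]_k) (z h : 'cV[R[i]]_m) :
  'cV[R[i]]_k := of_real ('d (realified F) (to_real z) (to_real h)).

Lemma of_realK m : cancel (@of_real m) to_real.
Proof.
move=> x; apply/rowP => j; rewrite -(splitK j) /to_real.
by case: (fintype.split j) => k /=; rewrite ?row_mxEl ?row_mxEr !mxE.
Qed.

Lemma to_realK m : cancel (@to_real m) of_real.
Proof.
move=> p; apply/colP => k; rewrite mxE row_mxEl row_mxEr !mxE.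
by case: (p k 0).
Qed.

Lemma sqnormE m (p : 'cV[R[i]]_m) :
  sqnorm p = \sum_k (complex.Re (p k 0) ^+ 2 + complex.Im (p k 0) ^+ 2).
Proof.
rewrite /sqnorm /cdot mxE raddf_sum /=; apply: eq_bigr => k _.
by rewrite !mxE; case: (p k 0) => a b /=; rewrite mulNr opprK !expr2.
Qed.

End HermitianSpace.

Section ProjectiveSpace.
Variables (R : realType) (n : nat).

(* The unit sphere S^(2n+1) of C^(n+1). *)
Record sphere := Sphere
  { sphere_val :> 'cV[R[i]]_(1 + n) ; _ : sqnorm sphere_val == 1 }.
HB.instance Definition _ := [isSub for sphere_val].
HB.instance Definition _ := [Choice of sphere by <:].

Definition phase (theta : R) : R[i] := cos theta +i* sin theta.

Lemma phase0 : phase 0 = 1.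
Proof. by rewrite /phase cos0 sin0. Qed.

Definition phase_eq : rel sphere :=
  fun p q => `[< exists theta : R, val q = phase theta *: val p >].

Lemma phase_eq_refl : reflexive phase_eq.
Proof.
move=> p; apply/asboolP; exists 0.
by rewrite phase0 scale1r.
Qed.

Lemma phaseD a b : phase (a + b) = phase a * phase b.
Proof.
by rewrite /phase cosD sinD; apply/eqP; rewrite eq_complex /= eqxx /= addrC.
Qed.

Lemma phase_eq_sym : symmetric phase_eq.
Proof.
suff h p q : phase_eq p q -> phase_eq q p by move=> p q; apply/idP/idP; exact: h.
move=> /asboolP[t ht]; apply/asboolP; exists (- t).
by rewrite ht scalerA -phaseD addNr phase0 scale1r.
Qed.

Lemma phase_eq_trans : transitive phase_eq.
Proof.
move=> q p r /asboolP[s hs] /asboolP[t ht]; apply/asboolP; exists (t + s).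
by rewrite ht hs scalerA -phaseD.
Qed.

Canonical phase_equiv :=
  EquivRel phase_eq phase_eq_refl phase_eq_sym phase_eq_trans.

Definition CP := {eq_quot phase_equiv}.

Definition cp_class (p : sphere) : CP := \pi_CP p.

Lemma cp_classP (p q : sphere) :
  cp_class p = cp_class q <-> exists theta : R, val q = phase theta *: val p.
Proof.
by split=> [/eqmodP/asboolP|h]; last by apply/eqmodP/asboolP.
Qed.

Lemma sphere_origin_subproof :
  sqnorm (col_mx (1%:M : 'M[R[i]]_1) (0 : 'cV[R[i]]_n)) == 1.
Proof.
rewrite sqnormE big_split_ord /= big_ord1 big1 ?addr0 => [|k _].
  by rewrite col_mxEu mxE /= expr1n expr0n addr0.
by rewrite col_mxEd mxE /= expr0n addr0.
Qed.

(* The point [w_0, w_1, ..., w_n]; meaningful only for w != 0, the value at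
   w = 0 being the arbitrary point [1, 0, ..., 0]. *)
Definition hcoord (w : 'cV[R[i]]_(1 + n)) : CP :=
  cp_class (insubd (Sphere sphere_origin_subproof)
                   (((cnorm w)^-1)%:C *: w)).

Lemma hcoord_sphere (p : sphere) : hcoord (val p) = cp_class p.
Proof.
rewrite /hcoord /cnorm (eqP (valP p)) sqrtr1 invr1 scale1r.
by rewrite valKd.
Qed.

(* The quotient of a matrix action: [z_0, z] |-> [z_0, A z]. *)
Definition cp_act (A : 'M[R[i]]_n) (c : CP) : CP :=
  hcoord ((block_mx (1%:M : 'M[R[i]]_1) 0 0 A : 'M[R[i]]_(1 + n)) *m val (repr c)).

Definition equivariant (v : 'cV[R[i]]_n -> CP) : Prop :=
  forall A : 'M[R[i]]_n, A \is unitarymx ->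
  forall z : 'cV[R[i]]_n, v (A *m z) = cp_act A (v z).

(* For w tangent to the sphere at p, this is the component of w that is
   orthogonal to the fibre direction i p. *)
Definition horizontal (p w : 'cV[R[i]]_(1 + n)) : 'cV[R[i]]_(1 + n) :=
  w - cdot p w *: p.

(* The metric at the class of p, evaluated on the projections to CP^n of vectors
   tangent to the sphere at p. The factor 4 makes each complex line isometric to
   the unit sphere of R^3. *)
Definition fubini_study (p w w' : 'cV[R[i]]_(1 + n)) : R :=
  4 * complex.Re (cdot (horizontal p w) (horizontal p w')).

Definition differentiable_lift (v : 'cV[R[i]]_n -> CP) (z : 'cV[R[i]]_n)
    (V : 'cV[R[i]]_n -> sphere) : Prop :=
  (\forall x \near to_real z, cp_class (V (of_real x)) = v (of_real x)) /\
  rdifferentiable (val \o V) z.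

(* The squared Hilbert-Schmidt norm of dv at z, computed in the standard
   orthonormal basis of R^(2n): dv is the projection of dV for a local lift V of
   v, and the result does not depend on the lift. The value at a point where v is
   not differentiable, i.e. has no lift, is 0 by convention. *)
Definition energy_density (v : 'cV[R[i]]_n -> CP) (z : 'cV[R[i]]_n) : R :=
  xget 0 [set e | exists2 V, differentiable_lift v z V &
    e = \sum_(j < n + n)
          let w := rdiff (val \o V) z (of_real (delta_mx 0 j)) in
          fubini_study (val (V z)) w w].

End ProjectiveSpace.

Section LebesgueMeasure.
Variable R : realType.

Local Notation mR := (measurableTypeR R).

Definition tuple_cons m (xy : mR * m.-tuple mR) : m.+1.-tuple mR :=
  [the m.+1.-tuple mR of xy.1 :: xy.2].

Lemma measurable_tuple_cons m : measurable_fun setT (@tuple_cons m).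
Proof.
exact: (@measurable_cons _ _ (mR * m.-tuple mR)%type mR fst m snd
  measurable_fst measurable_snd).
Qed.

Section Step.
Variables (m : nat) (mu : {measure set (m.-tuple mR) -> \bar R}).
Local Open Scope ereal_scope.

Definition lebesgue_step : set (m.+1.-tuple mR) -> \bar R :=
  pushforward ((@lebesgue_measure R) \x^ mu) (@tuple_cons m).

Let lebesgue_step0 : lebesgue_step set0 = 0.
Proof. by rewrite /lebesgue_step /pushforward preimage_set0 measure0. Qed.

Let lebesgue_step_ge0 A : 0 <= lebesgue_step A.
Proof. by rewrite /lebesgue_step /pushforward measure_ge0. Qed.

Let lebesgue_step_sigma_additive : semi_sigma_additive lebesgue_step.
Proof.
have mc := @measurable_tuple_cons m.
move=> F mF tF mUF; rewrite /lebesgue_step /pushforward preimage_bigcup.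
apply: measure_semi_sigma_additive.
- by move=> k; rewrite -[X in measurable X]setTI; exact: mc.
- apply/trivIsetP => /= i j _ _ ij; rewrite -preimage_setI.
  by move/trivIsetP : tF => /(_ _ _ _ _ ij) ->//; rewrite preimage_set0.
- by rewrite -preimage_bigcup -[X in measurable X]setTI; exact: mc.
Qed.

HB.instance Definition _ := isMeasure.Build _ _ _ lebesgue_step
  lebesgue_step0 lebesgue_step_ge0 lebesgue_step_sigma_additive.

End Step.

(* The m-fold product of the Lebesgue measure of R, on the product sigma-algebra
   of R^m. *)
Fixpoint lebesgue_tuple (m : nat) : {measure set (m.-tuple mR) -> \bar R} :=
  match m with
  | 0 => \d_([tuple] : 0.-tuple mR)
  | m'.+1 => lebesgue_step (lebesgue_tuple m')
  end.

(* The integral over C^n = R^(2n), in the coordinates of [of_real]. *)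
Definition integralC n (f : 'cV[R[i]]_n -> R) : \bar R :=
  (\int[lebesgue_tuple (n + n)]_x (f (of_real (\row_j tnth x j)))%:E)%E.

End LebesgueMeasure.

Definition energy (R : realType) n (v : 'cV[R[i]]_n -> CP R n) : \bar R :=
  ((2^-1)%:E * integralC (energy_density v))%E.

Section Profile.
Variables (R : realType) (n : nat) (u : R -> 'rV[R]_3).

Definition u1 (r : R) : R := u r 0 0.
Definition u2 (r : R) : R := u r 0 1.
Definition u3 (r : R) : R := u r 0 2%:R.

Definition C1_sphere_curve : Prop := forall r : R, 0 < r ->
  [/\ u1 r ^+ 2 + u2 r ^+ 2 + u3 r ^+ 2 = 1,
      derivable u r 1 & {for r, continuous (derive1 u)}].

(* For z != 0. At the south pole u_3 = -1 the vector of homogeneous coordinates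
   below degenerates to 0 / 0; there the identification
   (a_1, a_2, a_3) |-> [1 + a_3, a_1 + i a_2] of S^2 with CP^1 is extended by
   continuity, by [0, 1]. *)
Definition equivariant_form (z : 'cV[R[i]]_n) : CP R n :=
  let r := cnorm z in
  let e := (r^-1)%:C *: z in
  if u3 r == -1 then hcoord (col_mx (0 : 'M[R[i]]_1) e)
  else hcoord ((Num.sqrt 2 * Num.sqrt (1 + u3 r))^-1%:C *:
         col_mx ((1 + u3 r)%:C%:M : 'M[R[i]]_1) ((u1 r +i* u2 r) *: e)).

Definition profile_density (r : R) : R :=
  \sum_(k < 3) derive1 u r 0 k ^+ 2 +
  (r ^+ 2)^-1 * (1 - u3 r ^+ 2 + 2 * (2 * n%:R - 2) * (1 - u3 r)).

End Profile.

(* Main.v *)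
(* The rank-one projector P(z) = p p^* onto the complex line represented by
   v(z), where p is any unit representative, does not depend on the
   representative, and for a lift V with V(z) = p and w = dV(h) one has
     4 |horizontal part of w|^2 = 2 |w p^* + p w^*|^2 = 2 |dP(h)|^2,
   so the energy density is 2 |dP|^2. In the u coordinates, with e = z / r,
     P = [ (1 + u_3) / 2             (u_1 - i u_2) / 2 e^*   ]
         [ (u_1 + i u_2) / 2 e       (1 - u_3) / 2 e e^*     ],
   which makes sense at the south pole u_3 = -1 too. With s + i t = <e, h>, the
   number 2 |dP(h)|^2 is a quadratic polynomial A s^2 + B s t + C t^2 + D |h|^2,
   whose sum over the standard basis of R^(2n) is A + C + 2 n D. A
   differentiable local lift near z is P(x) q / |P(x) q|, with q representing
   v(z). *)

Require Import Defs.
From mathcomp Require Import all_boot all_order all_algebra complex.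
From mathcomp Require Import generic_quotient ring lra.
From mathcomp Require Import all_classical all_reals all_analysis.
From mathcomp Require Import measurable_realfun.
Import Order.TTheory GRing.Theory Num.Theory.
Import numFieldNormedType.Exports.
Local Open Scope ring_scope.

Set Implicit Arguments.
Unset Strict Implicit.

(** * Calculus of real directional differentials *)

Section DirectionalDifferential.
Local Open Scope classical_set_scope.
Context {R : realType} {V : normedModType R}.

(** The first-order expansion at [x] sees only the germ of the function. Locality matters because
    lifts are controlled only near a point. *)
Lemma near_eq_differentiable {W : normedModType R} (f g : V -> W) (x : V) :
  {near x, f =1 g} -> differentiable f x -> differentiable g x.
Proof.
move=> fg df.
have fgx : f x = g x by exact: nbhs_singleton fg.
have [dfc] := (diff_locallyP x f).1 df => dfo.
have dgo : g \o shift x = cst (g x) + 'd f x +o_ 0 id.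
  apply/eqaddoP => e e0.
  move/eqaddoP : dfo => /(_ e e0) dfo.
  (* The remainder lives near 0, so agreement near [x] is translated there. *)
  have fg0 : \forall h \near (0 : V), f (h + x) = g (h + x).
    have := near_shift (0 : V) x (fun y => f y = g y); rewrite /prop_near1
      subr0 /=.
    by move=> <-.
  near=> h.
  have fgh : f (h + x) = g (h + x) by near: h; exact: fg0.
  rewrite !fctE /= -fgh -fgx.
  by near: h; exact: dfo.
have dE : 'd g x = 'd f x :> (V -> W) by exact: diff_unique.
apply/diff_locallyP; split; first by move=> y; rewrite dE; exact: dfc.
by rewrite dE.
Unshelve. all: by end_near. Qed.

(** Full differentiability is included because ['d f x h] is meaningful only then and the chain rule
    needs more than a derivative along [h]. A single direction, even [h = 0], therefore certifies
    differentiability. *)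
Definition has_dir (f : V -> R) (x h : V) (l : R) :=
  differentiable f x /\ 'd f x h = l.

Lemma has_dir_near f g x h l :
  {near x, f =1 g} -> has_dir f x h l -> has_dir g x h l.
Proof.
move=> fg [df <-]; have dg := near_eq_differentiable fg df.
by split=> //; rewrite -!deriveE//; apply/esym/near_eq_derive.
Qed.

Lemma has_dir_cst (a : R) x h : has_dir (fun=> a) x h 0.
Proof. by split; [exact: differentiable_cst|rewrite diff_cst]. Qed.

Lemma has_dirD f g x h a b : has_dir f x h a -> has_dir g x h b ->
  has_dir (fun y => f y + g y) x h (a + b).
Proof.
by move=> [df <-] [dg <-]; split; [exact: differentiableD|rewrite diffD].
Qed.

Lemma has_dirN f x h a : has_dir f x h a -> has_dir (fun y => - f y) x h (- a).
Proof.
by move=> [df <-]; split; [exact: differentiableN|rewrite diffN].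
Qed.

Lemma has_dirM f g x h a b : has_dir f x h a -> has_dir g x h b ->
  has_dir (fun y => f y * g y) x h (f x * b + g x * a).
Proof.
by move=> [df <-] [dg <-]; split; [exact: differentiableM|rewrite diffM].
Qed.

Lemma has_dir_comp (g : R -> R) (f : V -> R) (x h : V) (a dg : R) :
  is_derive (f x) 1 g dg -> has_dir f x h a ->
  has_dir (fun y => g (f y)) x h (dg * a).
Proof.
move=> g' [df <-]; have [g'1 g'2] := g'.
have dg' : differentiable g (f x) by exact/derivable1_diffP.
split; first exact: (differentiable_comp df dg').
rewrite (diff_comp df dg') /= diff1E// derive1E g'2.
by rewrite mulrC.
Qed.

Lemma has_dir_sum n (f : 'I_n -> V -> R) x h (a : 'I_n -> R) :
  (forall i, has_dir (f i) x h (a i)) ->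
  has_dir (fun y => \sum_i f i y) x h (\sum_i a i).
Proof.
elim: n f a => [|n IHn] f a fa.
  by under eq_fun do rewrite big_ord0; rewrite big_ord0; exact: has_dir_cst.
under eq_fun do rewrite big_ord_recr; rewrite big_ord_recr /=.
exact: has_dirD (IHn _ _ _) _.
Qed.

End DirectionalDifferential.

Lemma has_dir_coord (R : realType) m (x h : 'rV[R]_m) (j : 'I_m) :
  has_dir (fun y : 'rV[R]_m => y 0 j) x h (h 0 j).
Proof.
have @f : {linear 'rV[R]_m -> R}.
  by exists (fun y : 'rV[R]_m => y 0 j); do 2![eexists]; do ?[constructor];
     rewrite ?mxE// => ? *; rewrite ?mxE//; move=> ?; rewrite !mxE.
split; first exact: differentiable_coord.
rewrite (_ : (fun _ => _) = f)// diff_lin//; exact: coord_continuous.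
Qed.

(** * Real and imaginary parts, and differentials of complex-valued functions over the reals *)

Section ComplexParts.
Local Open Scope complex_scope.
Context {R : rcfType}.
Implicit Types y z : R[i].

Lemma complex_eq y z :
  complex.Re y = complex.Re z -> complex.Im y = complex.Im z -> y = z.
Proof. by case: y z => [? ?] [? ?] /= -> ->. Qed.

Lemma ReD y z : complex.Re (y + z) = complex.Re y + complex.Re z.
Proof. by case: y z => ? ? []. Qed.

Lemma ImD y z : complex.Im (y + z) = complex.Im y + complex.Im z.
Proof. by case: y z => ? ? []. Qed.

Lemma ReM y z : complex.Re (y * z) =
  complex.Re y * complex.Re z - complex.Im y * complex.Im z.
Proof. by case: y z => ? ? []. Qed.

Lemma ImM y z : complex.Im (y * z) =
  complex.Re y * complex.Im z + complex.Im y * complex.Re z.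
Proof. by case: y z => ? ? []. Qed.

Lemma ReJ z : complex.Re z^*%C = complex.Re z. Proof. by case: z. Qed.

Lemma ImJ z : complex.Im z^*%C = - complex.Im z. Proof. by case: z. Qed.

End ComplexParts.

Section ComplexDirectionalDifferential.
Local Open Scope complex_scope.
Context {R : realType} {V : normedModType R}.

(** The two real parts are differentiated separately, since conjugation is differentiable over the
    reals only. *)
Definition has_cdir (f : V -> R[i]) (x h : V) (l : R[i]) :=
  has_dir (fun y => complex.Re (f y)) x h (complex.Re l) /\
  has_dir (fun y => complex.Im (f y)) x h (complex.Im l).

Lemma has_cdir_near f g (x h : V) l :
  {near x, f =1 g} -> has_cdir f x h l -> has_cdir g x h l.
Proof.
by move=> fg [fr fi]; split; [apply: has_dir_near fr|apply: has_dir_near fi];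
  apply: filterS fg => y /= ->.
Qed.

(** It compares two formulas for one function: below, the derivative of a projector read off a lift
    and the one read off the profile. *)
Lemma has_cdir_unique f (x h : V) l m :
  has_cdir f x h l -> has_cdir f x h m -> l = m.
Proof.
by case: l m => a b [c d] [[_ /= <-] [_ /= <-]] [[_ /= <-] [_ /= <-]].
Qed.

Lemma has_cdir_cst (a : R[i]) (x h : V) : has_cdir (fun=> a) x h 0.
Proof. by split; exact: has_dir_cst. Qed.

Lemma has_cdir_real f (x h : V) a : has_dir f x h a ->
  has_cdir (fun y => (f y)%:C) x h a%:C.
Proof. by move=> fa; split; [|exact: has_dir_cst]. Qed.

Lemma has_cdir_conj f (x h : V) a : has_cdir f x h a ->
  has_cdir (fun y => (f y)^*%C) x h a^*%C.
Proof.
move=> [fr fi]; split; rewrite ?ReJ ?ImJ.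
  by under eq_fun do rewrite ReJ.
by under eq_fun do rewrite ImJ; exact: has_dirN.
Qed.

Lemma has_cdirM f g (x h : V) a b : has_cdir f x h a -> has_cdir g x h b ->
  has_cdir (fun y => f y * g y) x h (f x * b + g x * a).
Proof.
move=> [fr fi] [gr gi].
split.
  under eq_fun do rewrite ReM.
  have := has_dirD (has_dirM fr gr) (has_dirN (has_dirM fi gi)).
  by congr has_dir; rewrite ReD !ReM; ring.
under eq_fun do rewrite ImM.
have := has_dirD (has_dirM fr gi) (has_dirM fi gr).
by congr has_dir; rewrite ImD !ImM; ring.
Qed.

Lemma has_cdir_sum n (f : 'I_n -> V -> R[i]) (x h : V) (a : 'I_n -> R[i]) :
  (forall i, has_cdir (f i) x h (a i)) ->
  has_cdir (fun y => \sum_i f i y) x h (\sum_i a i).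
Proof.
move=> fa; split; rewrite raddf_sum.
  by under eq_fun do rewrite raddf_sum; apply: has_dir_sum => i; case: (fa i).
by under eq_fun do rewrite raddf_sum; apply: has_dir_sum => i; case: (fa i).
Qed.

End ComplexDirectionalDifferential.

(** * Hermitian algebra: norms of rank-one variations and sums over the real basis *)

Section HermitianAlgebra.
Local Open Scope complex_scope.
Context {R : realType}.

Lemma cdotE m (p q : 'cV[R[i]]_m) : cdot p q = \sum_k (p k 0)^*%C * q k 0.
Proof. by rewrite /cdot mxE; apply: eq_bigr => k _; rewrite !mxE. Qed.

Definition sqmod (z : R[i]) : R := complex.Re z ^+ 2 + complex.Im z ^+ 2.

Lemma sqnorm_sqmod m (p : 'cV[R[i]]_m) : sqnorm p = \sum_k sqmod (p k 0).
Proof. exact: sqnormE. Qed.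

Lemma sqnorm_ge0 m (p : 'cV[R[i]]_m) : 0 <= sqnorm p.
Proof. by rewrite sqnormE; apply: sumr_ge0 => k _; rewrite addr_ge0 ?sqr_ge0.
  Qed.

Lemma sqnorm_eq0 m (p : 'cV[R[i]]_m) : (sqnorm p == 0) = (p == 0).
Proof.
apply/idP/eqP => [|->]; last first.
  by rewrite sqnormE big1// => k _; rewrite mxE /= expr0n addr0.
rewrite sqnormE psumr_eq0 => [/allP p0|k _]; last by rewrite addr_ge0 ?sqr_ge0.
apply/colP => k; have := p0 k (mem_index_enum k).
rewrite paddr_eq0 ?sqr_ge0// !sqrf_eq0 mxE => /andP[/eqP a0 /eqP b0].
by apply/eqP; rewrite eq_complex a0 b0 !eqxx.
Qed.

Lemma cdotpp m (p : 'cV[R[i]]_m) : cdot p p = (sqnorm p)%:C.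
Proof.
rewrite cdotE sqnorm_sqmod raddf_sum; apply: eq_bigr => k _ /=.
by rewrite /sqmod; case: (p k 0) => a b; apply/eqP; rewrite eq_complex /=;
  apply/andP; split; apply/eqP; ring.
Qed.

Lemma sqnorm_lin m (a b : R[i]) (p q : 'cV[R[i]]_m) :
  sqnorm (a *: p + b *: q) =
  sqmod a * sqnorm p + sqmod b * sqnorm q + 2 * complex.Re (a^*%C * b * cdot p
    q).
Proof.
rewrite cdotE !sqnorm_sqmod !mulr_sumr raddf_sum /= mulr_sumr -!big_split /=.
apply: eq_bigr => k _; rewrite !mxE /sqmod.
by case: a b (p k 0) (q k 0) => [? ?] [? ?] [? ?] [? ?] /=; ring.
Qed.

(** This is the squared Frobenius norm of w p^* + p w^*. The two square terms each sum to |w|^2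
    |p|^2, and the cross terms factor into the square of <p, w>. *)
Lemma sum_sqmod_sym m (p w : 'cV[R[i]]_m) :
  \sum_k \sum_l sqmod (w k 0 * (p l 0)^*%C + p k 0 * (w l 0)^*%C) =
  2 * (sqnorm w * sqnorm p + complex.Re (cdot p w ^+ 2)).
Proof.
have -> : sqnorm w * sqnorm p + complex.Re (cdot p w ^+ 2) =
    \sum_k \sum_l (sqmod (w k 0) * sqmod (p l 0)
     + complex.Re (((p k 0)^*%C * w k 0) * ((p l 0)^*%C * w l 0))).
  rewrite !sqnorm_sqmod expr2 cdotE !mulr_suml raddf_sum -big_split.
  apply: eq_bigr => k _ /=.
  by rewrite !mulr_sumr raddf_sum -big_split.
rewrite mulr_sumr.
under [RHS]eq_bigr do rewrite mulr_sumr.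
(* The square terms of the entry (k, l) are [F k l] and [F l k]; exchanging the order of summation
   gives them equal sums. *)
set F := fun k l => sqmod (w k 0) * sqmod (p l 0).
rewrite [RHS](_ : _ = \sum_k \sum_l (F k l + F l k +
    2 * complex.Re (((p k 0)^*%C * w k 0) * ((p l 0)^*%C * w l 0)))).
  apply: eq_bigr => k _; apply: eq_bigr => l _; rewrite /F /sqmod.
  by case: (p k 0) (w k 0) (p l 0) (w l 0) => [? ?] [? ?] [? ?] [? ?] /=; ring.
under eq_bigr do under eq_bigr do rewrite mulrDr.
under [RHS]eq_bigr do rewrite !big_split.
under eq_bigr do rewrite !big_split.
rewrite !big_split /=; congr (_ + _).
rewrite [X in _ = _ + X]exchange_big /= -big_split /=.
by apply: eq_bigr => k _; rewrite -big_split /=; apply: eq_bigr => l _; rewrite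
  /F; ring.
Qed.

(** Tangency makes <p, w> = i b purely imaginary, so that both sides equal 4 (|w|^2 - b^2). *)
Lemma fubini_study_proj n (p w : 'cV[R[i]]_(1 + n)) :
  sqnorm p = 1 -> complex.Re (cdot p w) = 0 ->
  fubini_study p w w =
  2 * \sum_k \sum_l sqmod (w k 0 * (p l 0)^*%C + p k 0 * (w l 0)^*%C).
Proof.
move=> p1 pw; rewrite sum_sqmod_sym p1 /fubini_study -/(sqnorm _) /horizontal.
rewrite addrC -scaleNr -[X in _ + X]scale1r sqnorm_lin p1.
move: pw; case: (cdot p w) => a b /= ->; rewrite /sqmod /=; ring.
Qed.

Section StandardBasis.
Context (m : nat).

Lemma of_real_delta_lshift (k : 'I_m) :
  of_real (delta_mx 0 (lshift m k) : 'rV[R]_(m + m)) = delta_mx k 0.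
Proof.
apply/colP => l; rewrite !mxE !eqxx /= eq_lshift eq_rlshift /= andbT.
by case: (l == k); rewrite ?complexr0.
Qed.

Lemma of_real_delta_rshift (k : 'I_m) :
  of_real (delta_mx 0 (rshift m k) : 'rV[R]_(m + m)) = 'i *: delta_mx k 0.
Proof.
apply/colP => l; rewrite !mxE !eqxx /= eq_rshift eq_lrshift /= andbT.
by case: (l == k); rewrite ?mulr1 ?mulr0.
Qed.

Lemma cdot_delta (p : 'cV[R[i]]_m) k : cdot p (delta_mx k 0) = (p k 0)^*%C.
Proof.
rewrite cdotE (bigD1 k)//= big1 ?mxE ?eqxx ?mulr1 ?addr0// => l lk.
by rewrite mxE (negbTE lk) mulr0.
Qed.

Lemma cdotZr (p q : 'cV[R[i]]_m) a : cdot p (a *: q) = a * cdot p q.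
Proof. by rewrite !cdotE mulr_sumr; apply: eq_bigr => k _; rewrite mxE mulrCA.
  Qed.

Lemma sqnormZ (p : 'cV[R[i]]_m) a : sqnorm (a *: p) = sqmod a * sqnorm p.
Proof.
rewrite !sqnorm_sqmod mulr_sumr; apply: eq_bigr => k _; rewrite mxE /sqmod.
by case: a (p k 0) => [? ?] [? ?] /=; ring.
Qed.

Lemma sqnorm_delta_basis (j : 'I_(m + m)) :
  sqnorm (of_real (delta_mx 0 j : 'rV[R]_(m + m))) = 1.
Proof.
have dk (k : 'I_m) : sqnorm (delta_mx k 0 : 'cV[R[i]]_m) = 1.
  by rewrite /sqnorm cdot_delta mxE !eqxx /=.
case: (split_ordP j) => k ->; rewrite ?of_real_delta_lshift
  ?of_real_delta_rshift//.
by rewrite sqnormZ dk /sqmod /=; ring.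
Qed.

(** The basis vectors pair up as d_k and i d_k. If e_k = a + i b, then <e, d_k> = a - i b and <e, i
    d_k> = b + i a: the mixed terms cancel and the squares add up to (A + C) |e_k|^2. *)
Lemma sum_quadratic_basis (e : 'cV[R[i]]_m) (A B C D : R) : sqnorm e = 1 ->
  \sum_(j < m + m) (let s := cdot e (of_real (delta_mx 0 j)) in
    A * complex.Re s ^+ 2 + B * (complex.Re s * complex.Im s)
      + C * complex.Im s ^+ 2 + D) = A + C + 2 * m%:R * D.
Proof.
rewrite big_split_ord /= -big_split /=.
move=> e1; transitivity (\sum_(k < m) ((A + C) * sqmod (e k 0) + 2 * D)).
  apply: eq_bigr => k _; rewrite of_real_delta_lshift of_real_delta_rshift.
  by rewrite cdotZr cdot_delta /sqmod; case: (e k 0) => a b /=; ring.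
rewrite big_split /= -mulr_sumr -sqnorm_sqmod e1 sumr_const card_ord -mulr_natl.
ring.
Qed.

End StandardBasis.
End HermitianAlgebra.

(** * The projector of a point of the given form *)

Section ProfileProjector.
Local Open Scope complex_scope.
Context {R : realType} {n : nat}.

(* The orthogonal projector onto the complex line [1 + b3, (b1 + i b2) e],
   valid at the south pole b3 = -1 too. *)
Definition profile_proj (b1 b2 b3 : R) (e : 'cV[R[i]]_n) : 'M[R[i]]_(1 + n) :=
  block_mx (const_mx ((1 + b3) / 2)%:C)
    (\row_l ((b1 / 2 +i* (b2 / 2)) * e l 0)^*%C)
    (\col_k ((b1 / 2 +i* (b2 / 2)) * e k 0))
    (\matrix_(k, l) (((1 - b3) / 2)%:C * (e k 0 * (e l 0)^*%C))).

Lemma ord_split_ind (P : 'I_(1 + n) -> Prop) :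
  P (lshift n 0) -> (forall k, P (rshift 1 k)) -> forall k, P k.
Proof. by move=> P0 PS k; case: (split_ordP k) => j -> //; rewrite ord1. Qed.

Lemma sqnorm_proj m (w : 'cV[R[i]]_m) :
  sqnorm w = complex.Re (\sum_k w k 0 * (w k 0)^*%C).
Proof.
rewrite sqnorm_sqmod raddf_sum; apply: eq_bigr => k _ /=.
by rewrite /sqmod; case: (w k 0) => a b /=; ring.
Qed.

(** Unit trace shows that any w with w w^* equal to this matrix is a unit vector, which [hcoord]
    then leaves unscaled. *)
Lemma profile_proj_tr b1 b2 b3 (e : 'cV[R[i]]_n) : sqnorm e = 1 ->
  complex.Re (\sum_k profile_proj b1 b2 b3 e k k) = 1.
Proof.
move=> e1; rewrite big_split_ord /= big_ord1 block_mxEul mxE.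
under eq_bigr do rewrite block_mxEdr mxE.
rewrite -mulr_sumr ReD ReM -sqnorm_proj e1 /=; lra.
Qed.

(** Two unit representatives differ by a phase, which cancels against its conjugate in p p^*. *)
Lemma cp_class_hcoord (p : sphere R n) w : sqnorm w = 1 ->
  cp_class p = hcoord w ->
  forall k l, val p k 0 * (val p l 0)^*%C = w k 0 * (w l 0)^*%C.
Proof.
move=> /eqP w1; rewrite -[w]/(val (Sphere w1)) hcoord_sphere => /esym/cp_classP.
case=> theta -> k l; rewrite !mxE rmorphM /= mulrACA.
rewrite (_ : phase theta * (phase theta)^*%C = 1) ?mul1r//.
rewrite /phase; apply/eqP; rewrite eq_complex /=.
have := cos2Dsin2 theta; rewrite !expr2 => h.
by apply/andP; split; apply/eqP; [rewrite -h; ring|ring].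
Qed.

Lemma cnorm_gt0 m (z : 'cV[R[i]]_m) : z != 0 -> 0 < cnorm z.
Proof. by move=> z0; rewrite sqrtr_gt0 lt_neqAle sqnorm_ge0 eq_sym sqnorm_eq0
  z0. Qed.

Lemma sqr_cnorm m (z : 'cV[R[i]]_m) : cnorm z ^+ 2 = sqnorm z.
Proof. by rewrite sqr_sqrtr// sqnorm_ge0. Qed.

Lemma sqnorm_normalized m (z : 'cV[R[i]]_m) : z != 0 ->
  sqnorm ((cnorm z)^-1%:C *: z) = 1.
Proof.
move=> z0; rewrite sqnormZ -sqr_cnorm /sqmod /=.
by have := cnorm_gt0 z0 => /lt0r_neq0 r0; field.
Qed.

Lemma equivariant_form_proj (u : R -> 'rV[R]_3) (p : sphere R n) (z :
  'cV[R[i]]_n) :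
  z != 0 ->
  let r := cnorm z in
  u1 u r ^+ 2 + u2 u r ^+ 2 + u3 u r ^+ 2 = 1 ->
  cp_class p = equivariant_form u z ->
  forall k l, val p k 0 * (val p l 0)^*%C =
    profile_proj (u1 u r) (u2 u r) (u3 u r) (r^-1%:C *: z) k l.
Proof.
move=> z0 r.
rewrite /equivariant_form -/r.
have := sqnorm_normalized z0; rewrite -/r; move: (_ *: z) => e e1.
move: (u1 u r) (u2 u r) (u3 u r) => b1 b2 b3 b_1.
(* It suffices to compute w w^* for the explicit homogeneous vector in each of the two cases; its
   unit norm then follows from the trace. *)
suff hw (w : 'cV[R[i]]_(1 + n)) :
    (forall k l, w k 0 * (w l 0)^*%C = profile_proj b1 b2 b3 e k l) ->
    cp_class p = hcoord w ->
    forall k l, val p k 0 * (val p l 0)^*%C = profile_proj b1 b2 b3 e k l.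
  case: ifPn => b3N1; apply: hw.
    have b3E : b3 = -1 by exact/eqP.
    (* At the south pole the sphere equation kills b1 and b2, hence the off-diagonal blocks. *)
    have [b10 b20] : b1 = 0 /\ b2 = 0.
      move: b_1; rewrite b3E sqrrN expr1n => /(congr1 (fun x => x - 1)).
      rewrite addrK subrr => /eqP; rewrite paddr_eq0 ?sqr_ge0// !sqrf_eq0.
      by move=> /andP[/eqP -> /eqP ->].
    have c0 : (0 / 2 +i* (0 / 2)) = 0 :> R[i] by rewrite mul0r.
    apply: ord_split_ind => [|k]; apply: ord_split_ind => [|l].
    - rewrite block_mxEul col_mxEu !mxE b3E mul0r; apply/eqP.
      by rewrite eq_complex /= subrr mul0r !eqxx.
    - rewrite block_mxEur col_mxEu col_mxEd b10 b20 !mxE mul0r.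
      by rewrite c0 mul0r conjc0.
    - rewrite block_mxEdl col_mxEu col_mxEd b10 b20 !mxE. 

      by rewrite conjc0 mulr0 c0 mul0r.
    - rewrite block_mxEdr !col_mxEd mxE b3E opprK.
      by rewrite (_ : (1 + 1) / 2 = 1 :> R) ?mul1r// divff.
  (* Away from the pole this positivity makes the square roots and inverses in the prefactor
     genuine. *)
  have b30 : 0 < 1 + b3.
    have : b3 ^+ 2 <= 1 by rewrite -b_1 lerDr addr_ge0 ?sqr_ge0.
    by move: b3N1; rewrite -subr_eq0 opprK => /eqP; nra.
  set s := Num.sqrt 2 * Num.sqrt (1 + b3).
  have s2 : s ^+ 2 = 2 * (1 + b3) by rewrite exprMn !sqr_sqrtr// ltW.
  have s0 : s != 0 by rewrite -sqrf_eq0 s2 mulf_neq0// gt_eqF.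
  have sV : s^-1 * s^-1 = (2 * (1 + b3))^-1 by rewrite -s2; field.
  have ww (x y : R[i]) : (s^-1%:C * x) * (s^-1%:C * y)^*%C =
      (2 * (1 + b3))^-1%:C * (x * y^*%C).
    by rewrite -sV; case: x y => [a b] [a' b']; apply: complex_eq => /=; ring.
  have b3n : 1 + b3 != 0 by rewrite gt_eqF.
  apply: ord_split_ind => [|k]; apply: ord_split_ind => [|l].
  - rewrite block_mxEul ![(_ *: col_mx _ _) _ _]mxE !col_mxEu !mxE eqxx ww.
    by apply: complex_eq => /=; field.
  - rewrite block_mxEur ![(_ *: col_mx _ _) _ _]mxE col_mxEu col_mxEd !mxE eqxx
    ww.
    by case: (e l 0) => x y; apply: complex_eq => /=; field.
  - rewrite block_mxEdl ![(_ *: col_mx _ _) _ _]mxE col_mxEu col_mxEd !mxE eqxx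
    ww.
    by case: (e k 0) => x y; apply: complex_eq => /=; field.
  - rewrite block_mxEdr ![(_ *: col_mx _ _) _ _]mxE !col_mxEd !mxE ww.
    (* The sphere equation in the form b1^2 + b2^2 = (1 - b3) (1 + b3) cancels the denominator. *)
    have -> : (1 - b3) / 2 = (2 * (1 + b3))^-1 * (b1 ^+ 2 + b2 ^+ 2).
      by rewrite (_ : b1 ^+ 2 + b2 ^+ 2 = 1 - b3 ^+ 2); [field|rewrite -b_1;
        ring].
    by case: (e k 0) (e l 0) => [x y] [x' y']; apply: complex_eq => /=; ring.
move=> wP pw k l; rewrite (cp_class_hcoord _ pw) ?wP//.
by rewrite sqnorm_proj; under eq_bigr do rewrite wP; exact: profile_proj_tr.
Qed.

End ProfileProjector.

(** * Differentials of the radius, of the unit direction and of coordinates *)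

Section ProfileProjectorDifferential.
Local Open Scope complex_scope.
Context {R : realType}.

Lemma has_dir_coord_comp (V : normedModType R) m (F : V -> 'rV[R]_m) x h j :
  differentiable F x -> has_dir (fun y => F y 0 j) x h ('d F x h 0 j).
Proof.
move=> dF; have [dc dcE] := has_dir_coord (F x) ('d F x h) j.
split; first exact: (differentiable_comp dF dc).
by rewrite (diff_comp dF dc) /= dcE.
Qed.

Lemma has_cdir_rdiff m k (F : 'cV[R[i]]_m -> 'cV[R[i]]_k) z h j :
  rdifferentiable F z ->
  has_cdir (fun y => F (of_real y) j 0) (to_real z) (to_real h) (rdiff F z h j
    0).
Proof.
move=> dF; rewrite /rdiff mxE; split => /=.
  have := has_dir_coord_comp (to_real h) (lshift k j) dF.
  by under eq_fun do rewrite /realified /= row_mxEl mxE.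
have := has_dir_coord_comp (to_real h) (rshift k j) dF.
by under eq_fun do rewrite /realified /= row_mxEr mxE.
Qed.

Lemma has_cdir_of_real m (x h : 'rV[R]_(m + m)) k :
  has_cdir (fun y => of_real y k 0) x h (of_real h k 0).
Proof.
split; rewrite mxE /=.
  by under eq_fun do rewrite mxE /=; exact: has_dir_coord.
by under eq_fun do rewrite mxE /=; exact: has_dir_coord.
Qed.

(** The derivative of |z|^2 is 2 Re <z, h>; the square root, differentiable only off 0, contributes
    1 / (2 r). *)
Lemma has_dir_cnorm m (x h : 'rV[R]_(m + m)) : of_real x != 0 ->
  has_dir (fun y => cnorm (of_real y)) x h
    (complex.Re (cdot ((cnorm (of_real x))^-1%:C *: of_real x) (of_real h))).
Proof.
move=> /cnorm_gt0 r0.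
have n0 : 0 < sqnorm (of_real x) by rewrite -sqr_cnorm exprn_gt0.
have dn : has_dir (fun y => sqnorm (of_real y)) x h
    (2 * complex.Re (cdot (of_real x) (of_real h))).
  under eq_fun do rewrite sqnormE.
  rewrite cdotE raddf_sum mulr_sumr.
  apply: has_dir_sum => k.
  have [fr fi] := has_cdir_of_real x h k.
  have := has_dirD (has_dirM fr fr) (has_dirM fi fi).
  congr has_dir.
  by case: (of_real x k 0) (of_real h k 0) => [a b] [c d] /=; ring.
have := has_dir_comp (is_derive1_sqrt n0) dn.
rewrite -/(cnorm (of_real x)); congr has_dir.
rewrite invfM !cdotE !raddf_sum !mulr_sumr; apply: eq_bigr => k _.
rewrite !mxE /=; move: (cnorm _) (lt0r_neq0 r0) => r {}r0.
by field.
Qed.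

Lemma is_derive_invr (r : R) : r != 0 ->
  is_derive r 1 (fun t : R => t^-1) (- r ^- 2).
Proof.
by move=> r0; have := @is_deriveV _ id r 1 1 r0 _; rewrite [_ *: 1]mulr1; apply.
Qed.

(** The quotient rule removes from h its real radial component Re <e, h> e and divides the remainder
    by r. *)
Lemma has_cdir_normalized m (x h : 'rV[R]_(m + m)) k : of_real x != 0 ->
  let r := cnorm (of_real x) in
  let e := r^-1%:C *: of_real x in
  has_cdir (fun y => ((cnorm (of_real y))^-1%:C *: of_real y) k 0) x h
    (r^-1%:C * (of_real h k 0 - (complex.Re (cdot e (of_real h)))%:C * e k 0)).
Proof.
move=> x0 r e; under eq_fun do rewrite mxE.
have r0 : r != 0 by exact: lt0r_neq0 (cnorm_gt0 x0).
have dr := has_dir_comp (f := fun y => cnorm (of_real y)) (is_derive_invr r0)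
  (has_dir_cnorm h x0).
have := has_cdirM (has_cdir_real dr) (has_cdir_of_real x h k).
congr has_cdir; rewrite -/r -/e [e k 0]mxE; move: (complex.Re _) => s.
case: (of_real h k 0) (of_real x k 0) => [a b] [c d].
by apply: complex_eq => /=; field.
Qed.

Lemma is_derive_row_coord m (u : R -> 'rV[R]_m) r j : derivable u r 1 ->
  is_derive r 1 (fun t => u t 0 j) (derive1 u r 0 j).
Proof.
move=> du; have := (derivable_mxP u r 1).1 du 0 j => duj.
by apply: DeriveDef => //; rewrite derive1E derive_mx// mxE.
Qed.

End ProfileProjectorDifferential.

(** * Derivative of the projector and its total squared norm *)

Section ProfileProjectorEnergy.
Local Open Scope complex_scope.
Context {R : realType} {n : nat}.

(** With c = (u_1 + i u_2) / 2, this is the derivative s c' e + c (h - s e) / r of c e, regrouped as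
    a combination of e and h. *)
Definition profile_offdiag (r s : R) (b db : 'rV[R]_3) (e h : 'cV[R[i]]_n) :
    'cV[R[i]]_n :=
  (s%:C * ((db 0 0 / 2 +i* (db 0 1 / 2)) - r^-1%:C * (b 0 0 / 2 +i* (b 0 1 /
    2))))
    *: e + (r^-1%:C * (b 0 0 / 2 +i* (b 0 1 / 2))) *: h.

(** Half of the derivative of (1 - u_3) / 2 e e^*: the derivative of the scalar is shared equally
    between w e^* and e w^*, whence the denominator 4. *)
Definition profile_diag (r s : R) (b db : 'rV[R]_3) (e h : 'cV[R[i]]_n) :
    'cV[R[i]]_n :=
  (s * (- db 0 2%:R / 4 - (1 - b 0 2%:R) / 2 / r))%:C *: e +
  ((1 - b 0 2%:R) / 2 / r)%:C *: h.

Lemma profile_offdiagE r s b db e h k : profile_offdiag r s b db e h k 0 =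
  s%:C * ((db 0 0 / 2 +i* (db 0 1 / 2)) - r^-1%:C * (b 0 0 / 2 +i* (b 0 1 / 2)))
    * e k 0 + r^-1%:C * (b 0 0 / 2 +i* (b 0 1 / 2)) * h k 0.
Proof. by rewrite !mxE. Qed.

Lemma profile_diagE r s b db e h k : profile_diag r s b db e h k 0 =
  (s * (- db 0 2%:R / 4 - (1 - b 0 2%:R) / 2 / r))%:C * e k 0 +
  ((1 - b 0 2%:R) / 2 / r)%:C * h k 0.
Proof. by rewrite !mxE. Qed.

(* The derivative of [profile_proj] in the direction h, where b = u(r),
   db = u'(r) and s = dr(h). *)
Definition dprofile_proj (r s : R) (b db : 'rV[R]_3) (e h : 'cV[R[i]]_n) :
    'M[R[i]]_(1 + n) :=
  let q := profile_offdiag r s b db e h in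
  let w := profile_diag r s b db e h in
  block_mx (const_mx (db 0 2%:R * s / 2)%:C) (\row_l (q l 0)^*%C) q
    (\matrix_(k, l) (w k 0 * (e l 0)^*%C + e k 0 * (w l 0)^*%C)).

Lemma has_cdir_profile_proj (u : R -> 'rV[R]_3) (x h : 'rV[R]_(n + n)) k l :
  of_real x != 0 ->
  let r := cnorm (of_real x) in
  let e := r^-1%:C *: of_real x in
  derivable u r 1 ->
  has_cdir (fun y =>
     profile_proj (u1 u (cnorm (of_real y))) (u2 u (cnorm (of_real y)))
       (u3 u (cnorm (of_real y))) ((cnorm (of_real y))^-1%:C *: of_real y) k l)
        x h
   (dprofile_proj r (complex.Re (cdot e (of_real h))) (u r) (derive1 u r) e
     (of_real h) k l).
Proof.
move=> x0 r e du.
have r0 : r != 0 by exact: lt0r_neq0 (cnorm_gt0 x0).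
have hu j : has_dir (fun y => u (cnorm (of_real y)) 0 j) x h
    (derive1 u r 0 j * complex.Re (cdot e (of_real h))).
  exact: (has_dir_comp (f := fun y => cnorm (of_real y))
    (is_derive_row_coord j du) (has_dir_cnorm h x0)).
have hu2 j a : has_dir (fun y => u (cnorm (of_real y)) 0 j / a) x h
    (derive1 u r 0 j * complex.Re (cdot e (of_real h)) / a).
  have := has_dirM (hu j) (has_dir_cst (a^-1) x h).
  by congr has_dir; rewrite mulr0 add0r mulrC.
have he k0 := has_cdir_normalized h k0 x0.
cbv zeta in he; rewrite -/r -/e in he.
move: (complex.Re _) hu hu2 he => s hu hu2 he.
have hc : has_cdir (fun y =>
    u1 u (cnorm (of_real y)) / 2 +i* (u2 u (cnorm (of_real y)) / 2)) x h
    ((derive1 u r 0 0 * s / 2) +i* (derive1 u r 0 1 * s / 2)).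
  by split => /=; exact: hu2.
have hq k0 : has_cdir (fun y =>
    (u1 u (cnorm (of_real y)) / 2 +i* (u2 u (cnorm (of_real y)) / 2)) *
    ((cnorm (of_real y))^-1%:C *: of_real y) k0 0) x h
    (profile_offdiag r s (u r) (derive1 u r) e (of_real h) k0 0).
  have := has_cdirM hc (he k0).
  congr has_cdir; rewrite -/r -/e.
  have -> : derive1 u r 0 0 * s / 2 +i* (derive1 u r 0 1 * s / 2) =
     s%:C * (derive1 u r 0 0 / 2 +i* (derive1 u r 0 1 / 2)).
    by apply: complex_eq => /=; ring.
  by rewrite profile_offdiagE /u1 /u2; ring.
move: k l; apply: ord_split_ind => [|k]; apply: ord_split_ind => [|l].
- under eq_fun do rewrite /profile_proj block_mxEul mxE; rewrite block_mxEul
  mxE.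
  apply: has_cdir_real.
  have := has_dirD (has_dir_cst (1 / 2) x h) (hu2 2%:R 2).
  rewrite add0r; congr has_dir.
  by apply/funext => y; rewrite /u3; ring.
- under eq_fun do rewrite /profile_proj block_mxEur mxE; rewrite block_mxEur
  mxE.
  exact: has_cdir_conj.
- under eq_fun do rewrite /profile_proj block_mxEdl mxE; rewrite block_mxEdl.
  exact: hq.
- under eq_fun do rewrite /profile_proj block_mxEdr mxE; rewrite block_mxEdr
  mxE.
  have hd : has_dir (fun y => (1 - u3 u (cnorm (of_real y))) / 2) x h
      (- (derive1 u r 0 2%:R * s / 2)).
    have := has_dirD (has_dir_cst (1 / 2) x h) (has_dirN (hu2 2%:R 2)).
    rewrite add0r; congr has_dir.
    by apply/funext => y; rewrite /u3; ring.
  have := has_cdirM (has_cdir_real hd) (has_cdirM (he k) (has_cdir_conj (he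
    l))).
  congr has_cdir; rewrite -/r -/e.
  rewrite !profile_diagE.
  rewrite /u3; case: (e k 0) (e l 0) (of_real h k 0) (of_real h l 0)
    => [? ?] [? ?] [? ?] [? ?].
  by apply: complex_eq => /=; field.
Qed.

(** The two off-diagonal blocks are conjugate and count twice; the lower right block has the shape
    treated by [sum_sqmod_sym]. *)
Lemma sum_sqmod_dprofile_proj r s b db (e h : 'cV[R[i]]_n) :
  \sum_k \sum_l sqmod (dprofile_proj r s b db e h k l) =
    (db 0 2%:R * s / 2) ^+ 2 + 2 * sqnorm (profile_offdiag r s b db e h) +
    2 * (sqnorm (profile_diag r s b db e h) * sqnorm e +
      complex.Re (cdot e (profile_diag r s b db e h) ^+ 2)).
Proof.
have sqmodJ (z : R[i]) : sqmod z^*%C = sqmod z by rewrite /sqmod ReJ ImJ sqrrN.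
rewrite -sum_sqmod_sym big_split_ord /= big_ord1 big_split_ord /= big_ord1.
rewrite block_mxEul mxE.
under eq_bigr do rewrite block_mxEur mxE sqmodJ.
under [X in _ + X = _]eq_bigr do rewrite big_split_ord /= big_ord1 block_mxEdl.
under [X in _ + X = _]eq_bigr do under eq_bigr do rewrite block_mxEdr mxE.
rewrite [X in _ + X = _]big_split sqnorm_sqmod [sqmod _%:C]/sqmod /= expr0n
  addr0.
have addE (x y t : R) : x + y + (y + t) = x + 2 * y + t by ring.
exact: addE.
Qed.

Lemma cdot_linr m (p q q' : 'cV[R[i]]_m) x y :
  cdot p (x *: q + y *: q') = x * cdot p q + y * cdot p q'.
Proof.
rewrite !cdotE !mulr_sumr -big_split; apply: eq_bigr => k _ /=.
by rewrite !mxE; ring.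
Qed.

Lemma sum_basis_dprofile_proj r (b db : 'rV[R]_3) (e : 'cV[R[i]]_n) : r != 0 ->
  sqnorm e = 1 -> b 0 0 ^+ 2 + b 0 1 ^+ 2 + b 0 2%:R ^+ 2 = 1 ->
  \sum_(j < n + n) (let h := of_real (delta_mx 0 j) in
    2 * \sum_k \sum_l sqmod (dprofile_proj r (complex.Re (cdot e h)) b db e h k
      l)) =
  \sum_(k < 3) db 0 k ^+ 2 + (r ^+ 2)^-1 *
    (1 - b 0 2%:R ^+ 2 + 2 * (2 * n%:R - 2) * (1 - b 0 2%:R)).
Proof.
move=> r0 e1 b1.
pose x1 := db 0 0 / 2; pose x2 := db 0 1 / 2; pose d3 := db 0 2%:R.
pose c1 := b 0 0 / 2; pose c2 := b 0 1 / 2; pose d := (1 - b 0 2%:R) / 2.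
(* Coefficients of s^2, s t, t^2 and |h|^2 in 2 |dP(h)|^2, where <e, h> = s + i t. Basis vectors
   have |h| = 1, so D enters as a constant. *)
pose A := 2 * (d3 ^+ 2 / 4 + 2 * (x1 ^+ 2 + x2 ^+ 2 - (c1 ^+ 2 + c2 ^+ 2) / r
  ^+ 2)
  + 2 * (d3 ^+ 2 / 8 - d ^+ 2 / r ^+ 2)).
pose B := 8 * (x2 * c1 - x1 * c2) / r.
pose C := - 4 * d ^+ 2 / r ^+ 2.
pose D := 4 * (c1 ^+ 2 + c2 ^+ 2 + d ^+ 2) / r ^+ 2.
have c12 : c1 ^+ 2 + c2 ^+ 2 = (1 - b 0 2%:R ^+ 2) / 4 by rewrite /c1 /c2; lra.
(* By the sphere equation D = 2 (1 - u_3) / r^2, so 2 n D carries the whole dependence on the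
   dimension. *)
transitivity (A + C + 2 * n%:R * D); last first.
  rewrite !big_ord_recr big_ord0 /= add0r.
  rewrite (_ : widen_ord _ _ = 0); last exact/val_inj.
  rewrite (_ : widen_ord _ _ = 1); last exact/val_inj.
  rewrite (_ : ord_max = 2%:R); last exact/val_inj.
  have -> : D = ((1 - b 0 2%:R ^+ 2) + (1 - b 0 2%:R) ^+ 2) / r ^+ 2.
    by rewrite /D c12 /d; field.
  have -> : A = d3 ^+ 2 + 4 * (x1 ^+ 2 + x2 ^+ 2)
     - ((1 - b 0 2%:R ^+ 2) + (1 - b 0 2%:R) ^+ 2) / r ^+ 2.
    by rewrite /A c12 /d; field.
  by rewrite /C /d3 /x1 /x2 /d; field.
rewrite -(sum_quadratic_basis A B C D e1); apply: eq_bigr => j _ /=.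
have := sqnorm_delta_basis (R := R) j; move: (of_real _) => h h1.
rewrite sum_sqmod_dprofile_proj e1 cdot_linr cdotpp !sqnorm_lin e1 h1.
rewrite /sqmod; case: (cdot e h) => s t /=.
by rewrite -/x1 -/x2 -/d3 -/c1 -/c2 -/d /A /B /C /D; field.
Qed.

End ProfileProjectorEnergy.

(** * Lifts and the pointwise energy density *)

Section EnergyDensity.
Local Open Scope complex_scope.
Local Open Scope classical_set_scope.
Context {R : realType} {n : nat}.

Lemma differentiable_row (V : normedModType R) m (F : V -> 'rV[R]_m) x :
  (forall j, differentiable (fun y => F y 0 j) x) -> differentiable F x.
Proof.
move=> dF.
rewrite (_ : F = \sum_(j < m) (fun y => F y 0 j *: (delta_mx 0 j : 'rV[R]_m))).
  by apply: differentiable_sum => j; exact: differentiableZl.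
by apply/funext => y; rewrite fct_sumE -row_sum_delta.
Qed.

(** One direction [h] is enough, because [has_cdir] contains differentiability of both parts. *)
Lemma has_cdir_rdifferentiable m k (F : 'cV[R[i]]_m -> 'cV[R[i]]_k) z h :
  (forall j, exists l, has_cdir (fun y => F (of_real y) j 0) (to_real z) h l) ->
  rdifferentiable F z.
Proof.
move=> dF; apply: differentiable_row => j; rewrite -(splitK j).
case: (fintype.split j) => i /=; have [l [[dr _] [di _]]] := dF i.
  by under eq_fun do rewrite /realified /= row_mxEl mxE.
by under eq_fun do rewrite /realified /= row_mxEr mxE.
Qed.

Lemma cdot_repr_proj (p q : sphere R n) k :
  \sum_l val p k 0 * (val p l 0)^*%C * val q l 0 = cdot (val p) (val q) * val p
    k 0.
Proof.
rewrite cdotE mulrC mulr_sumr; apply: eq_bigr => l _; ring.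
Qed.

(** The angle is [acos a] up to a sign, which is chosen to match the sine with [b]. *)
Lemma unit_phase (a : R[i]) : sqmod a = 1 -> exists theta, a = phase theta.
Proof.
case: a => a b; rewrite /sqmod /= => ab1.
have a1 : -1 <= a <= 1 by apply/andP; split; nra.
have sE : b ^+ 2 = sin (acos a) ^+ 2.
  by rewrite sin2cos2 acosK ?in_itv//= -ab1; ring.
move/eqP: sE; rewrite eqf_sqr => /orP[] /eqP bE.
  by exists (acos a); rewrite /phase bE acosK// in_itv.
by exists (- acos a); rewrite /phase cosN sinN acosK ?in_itv// bE.
Qed.

Lemma near_of_real_neq0 (x : 'rV[R]_(n + n)) : of_real x != 0 ->
  \forall y \near x, of_real y != 0.
Proof.
move=> x0; have [dn _] := has_dir_cnorm 0 x0.
have /cvgr_gt := differentiable_continuous dn.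
move=> /(_ 0 (cnorm_gt0 x0)); apply: filterS => y.
by apply: contraTneq => ->; rewrite /cnorm /sqnorm /cdot mulmx0 mxE sqrtr0 ltxx.
Qed.

Lemma lift_profile_proj (v : 'cV[R[i]]_n -> CP R n) (u : R -> 'rV[R]_3)
    (p : sphere R n) (z : 'cV[R[i]]_n) :
  C1_sphere_curve u -> z != 0 -> v z = equivariant_form u z ->
  cp_class p = v z ->
  forall k l, val p k 0 * (val p l 0)^*%C =
    profile_proj (u1 u (cnorm z)) (u2 u (cnorm z)) (u3 u (cnorm z))
      ((cnorm z)^-1%:C *: z) k l.
Proof.
move=> uC1 z0 vz pv; apply: equivariant_form_proj => //; last by rewrite -vz.
by have [] := uC1 _ (cnorm_gt0 z0).
Qed.

(** Any lift yields the same projector near [z], hence the same derivative dP; this also gives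
    independence of the lift. *)
Lemma lift_energy (v : 'cV[R[i]]_n -> CP R n) (u : R -> 'rV[R]_3)
    (z : 'cV[R[i]]_n) (V : 'cV[R[i]]_n -> sphere R n) :
  C1_sphere_curve u ->
  (forall z, z != 0 -> v z = equivariant_form u z) ->
  z != 0 -> differentiable_lift v z V ->
  \sum_(j < n + n)
    (let w := rdiff (val \o V) z (of_real (delta_mx 0 j)) in
     fubini_study (val (V z)) w w) = profile_density n u (cnorm z).
Proof.
move=> uC1 vu z0 [Vv dV].
have [b1 du _] := uC1 _ (cnorm_gt0 z0).
have r0 := lt0r_neq0 (cnorm_gt0 z0).
rewrite /profile_density -(sum_basis_dprofile_proj _ _ (sqnorm_normalized z0)
  b1)//.
apply: eq_bigr => j _ /=.
set h := of_real _; set w := rdiff _ _ _; set p := val (V z).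
have p1 : sqnorm p = 1 by apply/eqP; exact: (valP (V z)).
have dVk k : has_cdir (fun y => val (V (of_real y)) k 0) (to_real z) (to_real
  h) (w k 0).
  exact: has_cdir_rdiff.
have dVV k l : has_cdir (fun y => val (V (of_real y)) k 0 * (val (V (of_real
  y)) l 0)^*%C)
    (to_real z) (to_real h) (w k 0 * (p l 0)^*%C + p k 0 * (w l 0)^*%C).
  have := has_cdirM (dVk k) (has_cdir_conj (dVk l)).
  by congr has_cdir; rewrite to_realK -/p; ring.
(* Differentiating |V|^2 = 1 gives 2 Re <p, w> = 0, the tangency required by [fubini_study_proj]. *)
have pw : complex.Re (cdot p w) = 0.
  have dS : has_cdir (fun y => \sum_k val (V (of_real y)) k 0 * (val (V
    (of_real y)) k 0)^*%C)
      (to_real z) (to_real h) (\sum_k (w k 0 * (p k 0)^*%C + p k 0 * (w k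
        0)^*%C)).
    by apply: has_cdir_sum => k; exact: dVV.
  have d1 : has_cdir (fun y => \sum_k val (V (of_real y)) k 0 * (val (V
    (of_real y)) k 0)^*%C)
      (to_real z) (to_real h) 0.
    rewrite (_ : (fun _ => _) = fun=> 1); first exact: has_cdir_cst.
    apply/funext => y; have /eqP := valP (V (of_real y)).
    move=> q1; transitivity (cdot (val (V (of_real y))) (val (V (of_real y)))).
      by rewrite cdotE; apply: eq_bigr => k _; rewrite mulrC.
    by rewrite cdotpp q1.
  have := has_cdir_unique dS d1 => /(congr1 (@complex.Re R)).
  rewrite cdotE !raddf_sum /= => S0.
  apply: (mulfI (x := 2)) => //; rewrite mulr0 -[RHS]S0 mulr_sumr.
  apply: eq_bigr => k _.
  by case: (p k 0) (w k 0) => [? ?] [? ?] /=; ring.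
rewrite fubini_study_proj//; congr (2 * _).
apply: eq_bigr => k _; apply: eq_bigr => l _; congr sqmod.
apply: (has_cdir_unique (dVV k l)).
have := @has_cdir_profile_proj R n u (to_real z) (to_real h) k l.
rewrite !to_realK => /(_ z0 du).
apply: has_cdir_near; have := @near_of_real_neq0 (to_real z).
rewrite to_realK => /(_ z0); apply: filterS2 Vv => y Vy y0.
by rewrite (lift_profile_proj uC1 y0 (vu _ y0) Vy).
Qed.

Lemma differentiable_lift_exists (v : 'cV[R[i]]_n -> CP R n) (u : R -> 'rV[R]_3)
    (z : 'cV[R[i]]_n) :
  C1_sphere_curve u ->
  (forall z, z != 0 -> v z = equivariant_form u z) ->
  z != 0 -> exists V, differentiable_lift v z V.
Proof.
move=> uC1 vu z0.
pose q := repr (v z).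
have cpr (c : CP R n) : cp_class (repr c) = c by exact: reprK.
pose P (y : 'cV[R[i]]_n) := profile_proj (u1 u (cnorm y)) (u2 u (cnorm y)) (u3
  u (cnorm y))
  ((cnorm y)^-1%:C *: y).
pose f (y : 'cV[R[i]]_n) : 'cV[R[i]]_(1 + n) := \col_k (\sum_l P y k l * val q
  l 0).
have fE y : y != 0 -> f y = cdot (val (repr (v y))) (val q) *: val (repr (v y)).
  move=> y0; apply/colP => k; rewrite 2!mxE -cdot_repr_proj.
  apply: eq_bigr => l _; congr (_ * _).
  by rewrite (lift_profile_proj uC1 y0 (vu _ y0) (cpr _)).
(* The default [q] is taken only where f vanishes, which does not happen near [z] since f(z) = q. *)
exists (fun y => insubd q ((cnorm (f y))^-1%:C *: f y)).
have [_ du _] := uC1 _ (cnorm_gt0 z0).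
(* Only differentiability is wanted here, so the direction 0 serves as witness. *)
have df k : exists l, has_cdir (fun y => f (of_real y) k 0) (to_real z) 0 l.
  have dP l := @has_cdir_profile_proj R n u (to_real z) 0 k l.
  rewrite to_realK in dP.
  have := has_cdir_sum (fun l => has_cdirM (dP l z0 du) (has_cdir_cst (val q l
    0) _ _)).
  rewrite (_ : (fun y => f (of_real y) k 0) = fun y => \sum_l P (of_real y) k l
    * val q l 0).
    by move=> ?; eexists; eassumption.
  by apply/funext => y; rewrite mxE.
have q1 : sqnorm (val q) = 1 by exact/eqP/(valP q).
have fz : f z = val q by rewrite fE// cdotpp q1 scale1r.
have fz0 : 0 < sqnorm (f z) by rewrite fz q1.
have [l dn] : exists l, has_dir (fun y => cnorm (f (of_real y))) (to_real z) 0
  l.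
  have [g hg] := choice df.
  have hs : has_dir (fun y => sqnorm (f (of_real y))) (to_real z) 0
      (\sum_k (complex.Re (f z k 0) * complex.Re (g k) + complex.Re (f z k 0) *
        complex.Re (g k) +
         (complex.Im (f z k 0) * complex.Im (g k) + complex.Im (f z k 0) *
        complex.Im (g k)))).
    under eq_fun do rewrite sqnormE.
    apply: has_dir_sum => k; have [hr hi] := hg k.
    have := has_dirD (has_dirM hr hr) (has_dirM hi hi).
    by rewrite !to_realK; under eq_fun do rewrite -!expr2.
  eexists; apply: has_dir_comp hs; rewrite to_realK; exact: is_derive1_sqrt.
have near_f : \forall y \near to_real z, f (of_real y) != 0.
  have /cvgr_gt := differentiable_continuous dn.1.
  rewrite to_realK => /(_ 0); rewrite sqrtr_gt0 => /(_ fz0); apply: filterS =>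
    y.
  by apply: contraTneq => ->; rewrite /cnorm /sqnorm /cdot mulmx0 mxE sqrtr0
    ltxx.
have near0 : \forall y \near to_real z, of_real y != 0.
  by apply: near_of_real_neq0; rewrite to_realK.
have valV y : f y != 0 ->
    val (insubd q ((cnorm (f y))^-1%:C *: f y)) = (cnorm (f y))^-1%:C *: f y.
  by move=> fy; rewrite val_insubd sqnorm_normalized// eqxx.
split.
  apply: filterS2 near_f near0 => y fy y0.
  rewrite -[RHS]cpr; apply/esym/cp_classP; rewrite valV//.
  (* The normalised f(y) is a unit vector and a multiple of the unit representative of v(y), so the
     factor [a] is a phase and the class is v(y). *)
  pose a := (cnorm (f (of_real y)))^-1%:C * cdot (val (repr (v (of_real y))))
    (val q).
  have wE : (cnorm (f (of_real y)))^-1%:C *: f (of_real y) = a *: val (repr (v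
    (of_real y))).
    by rewrite {2}fE// scalerA.
  rewrite wE; have [|theta ->] := @unit_phase a; last by exists theta.
  have := sqnorm_normalized fy; rewrite wE sqnormZ.
  by have /eqP -> := valP (repr (v (of_real y))); rewrite mulr1.
apply: (@has_cdir_rdifferentiable _ _ _ _ 0) => k; have [g hg] := df k.
have n0 : cnorm (f z) != 0 by rewrite gt_eqF// sqrtr_gt0.
have dV : is_derive (cnorm (f (of_real (to_real z)))) 1 (fun t : R => t^-1)
    (- (cnorm (f z)) ^- 2).
  by rewrite to_realK; exact: is_derive_invr.
have := has_cdirM (has_cdir_real
  (has_dir_comp (f := fun y => cnorm (f (of_real y))) dV dn)) hg.
move=> hV; eexists; apply: has_cdir_near hV.
by apply: filterS near_f => y fy /=; rewrite valV// [RHS]mxE.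
Qed.

(** Existence of a lift rules out the default value of [xget], and [lift_energy] determines whatever
    value it selects. *)
Lemma energy_density_profile (v : 'cV[R[i]]_n -> CP R n) (u : R -> 'rV[R]_3)
    (z : 'cV[R[i]]_n) :
  C1_sphere_curve u ->
  (forall z, z != 0 -> v z = equivariant_form u z) ->
  z != 0 -> energy_density v z = profile_density n u (cnorm z).
Proof.
move=> uC1 vu z0; rewrite /energy_density; case: xgetP => [e _ [V dV ->]|none].
  exact: (lift_energy uC1 vu z0 dV).
have [V dV] := differentiable_lift_exists uC1 vu z0.
by case: (none (profile_density n u (cnorm z))); exists V; rewrite
  ?(lift_energy uC1 vu z0 dV).
Qed.

End EnergyDensity.

(** * Null sets, measurability and equality of integrals *)

Section LebesgueTuple.
Local Open Scope classical_set_scope.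
Context {R : realType}.
Local Notation mR := (measurableTypeR R).

(** Slices of a singleton along the first coordinate are singletons or empty, hence null. For
    [m = 0] the measure is a Dirac mass, so positivity matters. *)
Lemma lebesgue_tuple_set1 m (t : m.-tuple mR) : (0 < m)%N ->
  lebesgue_tuple R m [set t] = 0%E.
Proof.
case: m t => // m t _; rewrite /= /lebesgue_step /pushforward /product_measure2.
apply: integral0_eq => y _ /=.
have [yt|yt] := pselect (y = [tuple of behead t]).
  rewrite (_ : ysection _ _ = [set thead t]) ?lebesgue_measure_set1//.
  apply/seteqP; split => x /=; rewrite /ysection /= inE /=.
    by move=> <-; rewrite theadE.
  by move=> ->; rewrite yt [RHS]tuple_eta; exact/val_inj.
rewrite (_ : ysection _ _ = set0) ?measure0//.
apply/seteqP; split => x //=; rewrite /ysection /= inE /= => xyt.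
by apply: yt; rewrite -xyt; exact/val_inj.
Qed.

Lemma measurable_fun_setC1 d (T : measurableType d) d' (U : measurableType d')
    (f : T -> U) (a : T) : measurable [set a] ->
  measurable_fun (~` [set a]) f -> measurable_fun setT f.
Proof.
move=> ma mf; rewrite -(setvU [set a]).
apply/measurable_funU => //; first exact: measurableC.
split=> //; apply: (eq_measurable_fun (cst (f a))) => [x|].
  by rewrite inE => ->.
exact: measurable_cst.
Qed.

Definition tuple_point n (x : (n + n).-tuple mR) : 'cV[R[i]]_n :=
  of_real (\row_j tnth x j).

Lemma measurable_cnorm_tuple_point n :
  measurable_fun setT (fun x : (n + n).-tuple mR => cnorm (tuple_point x) : mR).
Proof.
have ms : measurable_fun setT (fun x : (n + n).-tuple mR => sqnorm (tuple_point
  x) : mR).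
  under eq_fun do rewrite sqnormE.
  apply: measurable_sum => k.
  under eq_fun do rewrite !mxE /=.
  by apply: measurable_funD; apply: measurable_funX; exact: measurable_tnth.
have mq := continuous_measurable_fun (@sqrt_continuous R).
exact: measurableT_comp mq ms.
Qed.

Lemma tuple_point0 n (x : (n + n).-tuple mR) :
  tuple_point x = 0 <-> x = [tuple 0 | _ < n + n].
Proof.
split=> [x0|->]; last first.
  by apply/colP => k; rewrite !mxE !tnth_mktuple.
apply: eq_from_tnth => j; rewrite tnth_mktuple.
have : \row_j tnth x j = to_real (0 : 'cV[R[i]]_n) by rewrite -x0 of_realK.
move/rowP/(_ j); rewrite mxE => ->; rewrite -(splitK j).
by case: (fintype.split j) => k /=; rewrite ?row_mxEl ?row_mxEr !mxE.
Qed.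

(** The origin is null, so values there do not count. Factoring through a continuous radial [D]
    supplies the measurability needed to replace one integrand by another equal to it almost
    everywhere. *)
Lemma integralC_eq n (f g : 'cV[R[i]]_n -> R) (D : R -> R) : (0 < n)%N ->
  {in `]0, +oo[, continuous D} ->
  (forall z, z != 0 -> f z = g z) -> (forall z, z != 0 -> g z = D (cnorm z)) ->
  integralC f = integralC g.
Proof.
move=> n0 Dc fg gD; rewrite /integralC -/(tuple_point _).
pose t0 : (n + n).-tuple mR := [tuple 0 | _ < n + n].
have mt0 : measurable [set t0].
  (* The origin is measurable as the zero set of the norm. *)
  rewrite (_ : [set t0] = (fun x => cnorm (tuple_point x)) @^-1` [set 0]).
    rewrite -[X in measurable X]setTI.
    by apply: measurable_cnorm_tuple_point => //; exact: measurable_set1.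
  apply/seteqP; split => x /=.
    by move=> /tuple_point0 ->; rewrite /cnorm /sqnorm /cdot mulmx0 mxE sqrtr0.
  move=> x0; apply/tuple_point0/eqP; apply: contraTT isT => /cnorm_gt0.
  by rewrite x0 ltxx.
have t0N x : x <> t0 -> tuple_point x != 0.
  by move=> xt; apply/eqP => /tuple_point0.
have mh (h : 'cV[R[i]]_n -> R) : (forall z, z != 0 -> h z = D (cnorm z)) ->
    measurable_fun setT (fun x => (h (tuple_point x))%:E).
  move=> hD; apply/measurable_EFinP; apply: (measurable_fun_setC1 mt0).
  apply: (eq_measurable_fun (D \o (fun x => cnorm (tuple_point x)))) => [x|].
    by rewrite inE => /t0N xN /=; rewrite hD.
  have mr : measurable_fun (~` [set t0]) (fun x => cnorm (tuple_point x) : mR).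
    exact: (measurable_funTS (@measurable_cnorm_tuple_point n)).
  have mD : measurable_fun (`]0, +oo[ : set mR) (D : mR -> mR).
    by apply: open_continuous_measurable_fun => // r; rewrite inE; exact: Dc.
  apply: (measurable_comp _ _ mD mr) => //.
  by move=> _ [x /t0N xN <-] /=; rewrite in_itv /= cnorm_gt0.
apply: ae_eq_integral => //.
- by apply: mh => z z0; rewrite fg// gD.
- exact: mh.
exists [set t0]; split => //.
  by apply: lebesgue_tuple_set1; rewrite addn_gt0 n0.
move=> x /= H; apply: contrapT => /t0N xN; apply: H => _ /=.
by rewrite fg.
Qed.

End LebesgueTuple.

(** * Continuity of the radial density, and the energy formula *)

Lemma continuous_profile_density (R : realType) n (u : R -> 'rV[R]_3) :
  C1_sphere_curve u -> {in `]0, +oo[%classic, continuous (profile_density n u)}.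
Proof.
move=> uC1 r; rewrite inE /= in_itv /= andbT => r0.
have [_ du cdu] := uC1 r r0.
have cu k : {for r, continuous (fun t => u t 0 k)}.
  have [duk _] := is_derive_row_coord k du.
  exact/differentiable_continuous/derivable1_diffP.
have cdu_k k : {for r, continuous (fun t => derive1 u t 0 k)}.
  apply: (@continuous_comp _ _ _ (derive1 u) (fun M : 'rV[R]_3 => M 0 k)) => //.
  exact: coord_continuous.
have sqrc (f : R -> R) : {for r, continuous f} -> {for r, continuous (fun t =>
  f t ^+ 2)}.
  by move=> cf; exact: (continuousM cf cf).
have cst_c (a : R) : {for r, continuous (fun=> a : R)} by exact: cvg_cst.
have cdu2 : {for r, continuous (fun t => \sum_(k < 3) derive1 u t 0 k ^+ 2)}.
  have sq k := sqrc _ (cdu_k k).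
  rewrite (_ : (fun t => _) = fun t => derive1 u t 0 0 ^+ 2 + derive1 u t 0 1
    ^+ 2 +
    derive1 u t 0 2%:R ^+ 2).
    exact: (continuousD (continuousD (sq 0) (sq 1)) (sq 2%:R)).
  apply/funext => t; rewrite !big_ord_recr big_ord0 /= add0r.
  by congr (_ ^+ 2 + _ ^+ 2 + _ ^+ 2); congr (_ _ _); exact/val_inj.
have cV : {for r, continuous (fun t : R => (t ^+ 2)^-1 : R)}.
  have rr0 : r ^+ 2 != 0 by rewrite expf_neq0// gt_eqF.
  by apply: (continuousV (s := fun t : R => t ^+ 2)) => //; exact:
    exprn_continuous.
have c3 := cu 2%:R.
have cd := continuousM (cst_c (2 * (2 * n%:R - 2))) (continuousB (cst_c 1) c3).
exact: (continuousD cdu2 (continuousM cV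
  (continuousD (continuousB (cst_c 1) (sqrc _ c3)) cd))).
Qed.

Theorem proposition2p2 (R : realType) (n : nat) (v : 'cV[R[i]]_n -> CP R n)
    (u : R -> 'rV[R]_3) (n_ge2 : (2 <= n)%N)
    (v_equivariant : equivariant v)
    (u_C1 : C1_sphere_curve u)
    (v_form : forall z : 'cV[R[i]]_n, z != 0 -> v z = equivariant_form u z) :
  energy v =
  ((2^-1)%:E * integralC (fun z : 'cV[R[i]]_n => profile_density n u (cnorm z)))%E.
Proof.
rewrite /energy; congr (_ * _)%E.
(* The two densities agree off the origin, and n >= 2 makes the domain of positive dimension. *)
apply: (integralC_eq (D := profile_density n u)) => //.
- exact: ltn_trans n_ge2.
- exact: continuous_profile_density.
by move=> z z0; exact: energy_density_profile.
Qed.
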